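(* Let $\theta=(\alpha,\beta,\gamma)\in S_n\times S_n\times S_n$ be an autotopism of a Latin square $L$ of order $n$. If $i$ belongs to an $a$-cycle of $\alpha$ and $j$ belongs to a $b$-cycle of $\beta$, then $L(i,j)$ belongs to a $c$-cycle of $\gamma$, where $\mathrm{lcm}(a,b)=\mathrm{lcm}(b,c)=\mathrm{lcm}(a,c)=\mathrm{lcm}(a,b,c)$.
   Context: A Latin square of order $n$ is an $n\times n$ array $L=L(i,j)$ with rows, columns and symbols indexed by $[n]=\{1,\dots,n\}$ such that the symbols in every row and in every column are distinct. A triple $(\alpha,\beta,\gamma)\in S_n\times S_n\times S_n$ is an autotopism of $L$ if $\gamma(L(i,j))=L(\alpha(i),\beta(j))$ for all $i,j\in[n]$. A $c$-cycle is a cycle of length $c$ in the disjoint cycle decomposition; fixed points are cycles of length $1$. *)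

(* Defs.v *)
From mathcomp Require Import all_boot all_fingroup all_algebra.

Set Implicit Arguments.
Unset Strict Implicit.
Unset Printing Implicit Defensive.

(* Rows, columns and symbols are indexed by 'I_n = {0, ..., n-1}. *)
Definition latin_square (n : nat) (L : 'M['I_n]_n) : Prop :=
  (forall i, injective (fun j => L i j)) /\ (forall j, injective (fun i => L i j)).

Definition autotopism (n : nat) (L : 'M['I_n]_n)
    (theta : 'S_n * 'S_n * 'S_n) : Prop :=
  let: (alpha, beta, gamma) := theta in
  forall i j, gamma (L i j) = L (alpha i) (beta j).

(* The elements of [porbits s] are the supports of the cycles of s, with each
   fixed point contributing a singleton. *)
Definition in_cycle_of_length (T : finType) (s : {perm T}) (c : nat) (x : T) : Prop :=
  exists C : {set T}, [/\ C \in porbits s, #|C| = c & x \in C].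

(* Main.v *)
Require Import Defs.
From mathcomp Require Import all_boot all_fingroup all_algebra.

(** The cycle of [x] under [s] has length dividing [k] iff [s ^+ k] fixes [x].
    In the relation [gamma^k (L i j) = L (alpha^k i) (beta^k j)], if two of
    [i], [j], [L i j] are fixed, then by the Latin property so is the third.
    Taking for [k] the lcm of two of the cycle lengths shows that each length
    divides the lcm of the other two. *)

Lemma perm_expg_fix_dvdn (T : finType) (s : {perm T}) (x : T) (k : nat) :
  ((s ^+ k)%g x == x) = (#|porbit s x| %| k).
Proof.
set m := #|porbit s x|.
have m_gt0 : 0 < m by rewrite card_gt0; apply/set0Pn; exists x; exact: porbit_id.
have fixM q : iter (q * m) s x = x.
  by elim: q => // q IHq; rewrite mulSn iterD IHq iter_porbit.
(* Whole turns around the cycle drop out, leaving [k %% m] iterations. *)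
rewrite permX {1}(divn_eq k m) addnC iterD fixM /dvdn.
apply/eqP/eqP => [fixr | -> //].
(* The first [m] iterates of [x] are distinct, so equal entries at positions [k %% m] and [0] force
   equal positions. *)
apply/eqP; rewrite -(nth_uniq x _ _ (uniq_traject_porbit s x)) ?size_traject ?ltn_mod //.
by rewrite !nth_traject ?ltn_mod // fixr.
Qed.

Lemma in_cycle_of_lengthP (T : finType) (s : {perm T}) (c : nat) (x : T) :
  in_cycle_of_length s c x <-> #|porbit s x| = c.
Proof.
split=> [[C [/imsetP[y _ ->] <-]] | <-].
  by rewrite -eq_porbit_mem => /eqP ->.
by exists (porbit s x); split; [exact: imset_f | | exact: porbit_id].
Qed.

Lemma autotopism_expg (n : nat) (L : 'M['I_n]_n) (alpha beta gamma : 'S_n) (k : nat) :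
  autotopism L (alpha, beta, gamma) ->
  autotopism L (alpha ^+ k, beta ^+ k, gamma ^+ k)%g.
Proof.
move=> autL i j; rewrite !permX.
by elim: k => //= k ->; exact: autL.
Qed.

(** Each pairwise lcm absorbs the missing third number, hence equals the lcm of all three. *)
Lemma lcmn_eq_of_dvdn (a b c : nat) :
  a %| lcmn b c -> b %| lcmn a c -> c %| lcmn a b ->
  [/\ lcmn a b = lcmn b c, lcmn b c = lcmn a c & lcmn a c = lcmn (lcmn a b) c].
Proof.
move=> dva dvb dvc; rewrite (lcmnAC a b) (lcmn_idPl dvb).
by split=> //; apply/eqP; rewrite eqn_dvd !dvdn_lcm
  !(dva, dvb, dvc, dvdn_lcml, dvdn_lcmr).
Qed.

Theorem lemma3p6 (n : nat) (L : 'M['I_n]_n) (alpha beta gamma : 'S_n)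
    (latinL : latin_square L) (autL : autotopism L (alpha, beta, gamma))
    (i j : 'I_n) (a b : nat)
    (ia : in_cycle_of_length alpha a i) (jb : in_cycle_of_length beta b j) :
  exists c : nat,
    in_cycle_of_length gamma c (L i j) /\
    [/\ lcmn a b = lcmn b c, lcmn b c = lcmn a c
      & lcmn a c = lcmn (lcmn a b) c].
Proof.
move: ia jb => /in_cycle_of_lengthP ia /in_cycle_of_lengthP jb.
exists #|porbit gamma (L i j)|; split; first exact/in_cycle_of_lengthP.
have [rowI colI] := latinL.
have autX k := autotopism_expg n L alpha beta gamma k autL i j.
have fixa k : a %| k -> (alpha ^+ k)%g i = i.
  by rewrite -ia -perm_expg_fix_dvdn => /eqP.
have fixb k : b %| k -> (beta ^+ k)%g j = j.
  by rewrite -jb -perm_expg_fix_dvdn => /eqP.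
have fixc k : #|porbit gamma (L i j)| %| k -> (gamma ^+ k)%g (L i j) = L i j.
  by rewrite -perm_expg_fix_dvdn => /eqP.
apply: lcmn_eq_of_dvdn.
(* Column [j] and the symbol [L i j] are fixed by the [k]-th powers, so rows [(alpha ^+ k)%g i] and
   [i] carry the same symbol in column [j]. *)
- rewrite -{1}ia -perm_expg_fix_dvdn; apply/eqP/(colI j).
  set k := lcmn _ _; have := autX k.
  by rewrite fixb ?dvdn_lcml // fixc ?dvdn_lcmr.
- rewrite -{1}jb -perm_expg_fix_dvdn; apply/eqP/(rowI i).
  set k := lcmn _ _; have := autX k.
  by rewrite fixa ?dvdn_lcml // fixc ?dvdn_lcmr.
(* Row and column are both fixed, so the cell keeps its symbol. *)
- rewrite -perm_expg_fix_dvdn autX.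
  by rewrite fixa ?dvdn_lcml // fixb ?dvdn_lcmr.
Qed.
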